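(* Let $a,d,k$ be positive integers with $\gcd(a,d)=1$ and $2\le k\le a$. Let $\lambda$ be a complex number with $\lambda\ne 0$, $\lambda\neq 1$ and $\lambda^{a}=1$. Then for every positive integer $\mu$, $$ \begin{aligned} s_\mu^{(\lambda)}(a,a+d,\dots,a+(k-1)d) &=\frac{1}{\mu+1}\sum_{n=0}^\mu\binom{\mu+1}{n}B_n a^{n-1}\sum_{i=1}^{a-1}\bigl(m_i^{\mu+1-n}-i^{\mu+1-n}\bigr)\lambda^{m_i}\\ &=\frac{1}{\mu+1}\sum_{n=0}^\mu\binom{\mu+1}{n}B_n a^{n-1}\sum_{i=1}^{a-1}m_i^{\mu+1-n}\lambda^{m_i} +\frac{(-1)^{\mu+1}}{(\lambda-1)^{\mu+1}}\sum_{j=0}^{\mu-1}\left\langle{\mu\atop j}\right\rangle\lambda^{j+1}. \end{aligned} $$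
   Context: For positive integers $a_1,\dots,a_k$ with $\gcd(a_1,\dots,a_k)=1$, $\mathrm{R}(a_1,\dots,a_k)$ denotes the set of positive integers that can be written as a nonnegative integer combination of $a_1,\dots,a_k$, $\mathrm{NR}(a_1,\dots,a_k)$ denotes the (finite) set of positive integers that cannot be so written, and $s_\mu^{(\lambda)}(a_1,\dots,a_k):=\sum_{n\in \mathrm{NR}(a_1,\dots,a_k)}\lambda^n n^\mu$. For $1\le i\le a-1$, $m_i$ is the least positive integer with $m_i\equiv i\pmod a$ and $m_i\in\mathrm{R}(a,a+d,\dots,a+(k-1)d)$. The Bernoulli numbers $B_n$ are defined by $\frac{x}{e^x-1}=\sum_{n=0}^\infty B_n\frac{x^n}{n!}$ (so $B_1=-\frac12$). The Eulerian numbers are $\left\langle{n\atop m}\right\rangle=\sum_{k=0}^{m}(-1)^k\binom{n+1}{k}(m-k+1)^n$; equivalently $\sum_{k=0}^\infty k^nx^k=\frac{1}{(1-x)^{n+1}}\sum_{m=0}^{n-1}\left\langle{n\atop m}\right\rangle x^{m+1}$ for $n\ge 1$. *)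

(* Defs.v *)
From HB Require Import structures.
From mathcomp Require Import all_boot all_order all_algebra.
From mathcomp Require Import boolp classical_sets functions cardinality fsbigop.
From mathcomp Require Import reals.
From mathcomp Require Import complex.

Set Implicit Arguments.
Unset Strict Implicit.
Unset Printing Implicit Defensive.

Import Order.TTheory GRing.Theory Num.Theory.

Local Open Scope classical_set_scope.
Local Open Scope ring_scope.

Definition representable (k : nat) (g : 'I_k -> nat) : set nat :=
  [set n | (0 < n)%N /\ exists c : 'I_k -> nat, n = (\sum_(i < k) c i * g i)%N].

Definition nonrepresentable (k : nat) (g : 'I_k -> nat) : set nat :=
  [set n | (0 < n)%N /\ ~ representable g n].

(* [\sum_(n \in A)] is 0 by convention on an infinite support; the set of
   nonrepresentable integers is finite as soon as the generators have gcd 1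
   (see [finite_nonrepresentable_arith] for the case used here). *)
Definition weighted_sum (F : nzRingType) (lambda : F) (mu k : nat)
    (g : 'I_k -> nat) : F :=
  \sum_(n \in nonrepresentable g) (lambda ^+ n * n%:R ^+ mu).

Definition arith (a d k : nat) : 'I_k -> nat := fun i => (a + i * d)%N.

Definition residue_set (a d k i : nat) : set nat :=
  [set m | (0 < m)%N /\ m = i %[mod a] /\ representable (@arith a d k) m].

(* The junk value 0 is never used for [0 < i < a] when a and d are coprime and
   [1 < k], see [min_residueP]. *)
Definition min_residue (a d k i : nat) : nat :=
  xget 0%N [set m | residue_set a d k i m /\
                    forall m', residue_set a d k i m' -> (m <= m')%N].

(* Formal power series over rat, as sequences of coefficients. *)
Definition fps_mul (f g : nat -> rat) : nat -> rat :=
  fun n => \sum_(j < n.+1) f j * g (n - j)%N.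
Definition fps_sub (f g : nat -> rat) : nat -> rat := fun n => f n - g n.
Definition fps_one : nat -> rat := fun n => (n == 0%N)%:R.
Definition fps_X : nat -> rat := fun n => (n == 1%N)%:R.
Definition fps_exp : nat -> rat := fun n => n`!%:R^-1.
Definition fps_egf (B : nat -> rat) : nat -> rat := fun n => B n / n`!%:R.

(* sum_n B_n x^n / n! = x / (e^x - 1), the quotient of formal power series being
   the series whose product with e^x - 1 is x; it exists and is unique, see
   [bernoulliP] and [bernoulli_unique]. *)
Definition bernoulli : nat -> rat :=
  xget (fun=> 0)
    [set B | fps_mul (fps_egf B) (fps_sub fps_exp fps_one) = fps_X].

Definition eulerian (n m : nat) : int :=
  \sum_(0 <= k < m.+1) (-1) ^+ k * ('C(n.+1, k) * (m - k + 1) ^ n)%N%:Z.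

Lemma fps_mul_expm1 (b : nat -> rat) (n : nat) :
  fps_mul b (fps_sub fps_exp fps_one) n.+1
  = b n + \sum_(j < n) b j / (n.+1 - j)`!%:R.
Proof.
rewrite /fps_mul /fps_sub /fps_exp /fps_one !big_ord_recr /=.
rewrite subnn subSnn !fact0 factS fact0 !invr1 !subrr mulr0 addr0 subr0 mulr1.
rewrite addrC; congr (_ + _); apply: eq_bigr => j _.
have : (0 < n.+1 - j)%N by rewrite subn_gt0 ltnS ltnW.
by case: (n.+1 - j)%N => // p _; rewrite subr0.
Qed.

Lemma bernoulli_exists : exists B : nat -> rat,
  fps_mul (fps_egf B) (fps_sub fps_exp fps_one) = fps_X.
Proof.
pose nxt (s : seq rat) :=
  (size s == 0%N)%:R - \sum_(j < size s) s`_j / ((size s).+1 - j)`!%:R.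
pose s n := iter n (fun s => rcons s (nxt s)) [::].
have ss n : size (s n) = n by elim: n => //= n IH; rewrite size_rcons IH.
have sE n j : (j < n)%N -> (s n)`_j = nxt (s j).
  elim: n => // n IH; rewrite ltnS leq_eqVlt => /orP[/eqP ->|jn] /=.
    by rewrite nth_rcons ss ltnn eqxx.
  by rewrite nth_rcons ss jn IH.
exists (fun n => nxt (s n) * n`!%:R); rewrite funeqE => -[|n].
  by rewrite /fps_mul /fps_sub /fps_exp /fps_one /fps_X big_ord1 /= fact0 subrr mulr0.
have eE m : fps_egf (fun n => nxt (s n) * n`!%:R) m = nxt (s m).
  by rewrite /fps_egf mulfK // pnatr_eq0 -lt0n fact_gt0.
rewrite fps_mul_expm1 eE {1}/nxt ss /fps_X eqSS -addrA addrC.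
rewrite (_ : - _ + _ = 0) ?add0r //; apply/eqP; rewrite addrC subr_eq0; apply/eqP.
by apply: eq_bigr => j _; rewrite eE sE.
Qed.

Lemma bernoulliP :
  fps_mul (fps_egf bernoulli) (fps_sub fps_exp fps_one) = fps_X.
Proof. exact: (xgetPex _ bernoulli_exists). Qed.

Lemma bernoulli_unique (B : nat -> rat) :
  fps_mul (fps_egf B) (fps_sub fps_exp fps_one) = fps_X -> B = bernoulli.
Proof.
move=> HB; rewrite funeqE => n.
have H m : fps_egf B m = fps_egf bernoulli m.
  elim/ltn_ind: m => m IH.
  have := fps_mul_expm1 (fps_egf B) m.
  rewrite HB -bernoulliP fps_mul_expm1.
  have -> : \sum_(j < m) fps_egf B j / (m.+1 - j)`!%:R =
            \sum_(j < m) fps_egf bernoulli j / (m.+1 - j)`!%:R.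
    by apply: eq_bigr => j _; rewrite IH.
  by move/addIr.
by apply: (mulIf _ (H n)); rewrite invr_eq0 pnatr_eq0 -lt0n fact_gt0.
Qed.

Lemma representable_arith2 (a d k x y : nat) : (0 < a)%N -> (1 < k)%N ->
  (0 < x * a + y * (a + d))%N ->
  representable (@arith a d k) (x * a + y * (a + d))%N.
Proof.
move=> a0; case: k => [|[|k]] // _ n0; split=> //.
exists (fun i : 'I_k.+2 => if i == 0%N :> nat then x else
                           if i == 1%N :> nat then y else 0%N).
rewrite !big_ord_recl /= big1 => [|i _]; last by rewrite mul0n.
by rewrite /arith /= /bump /= mul0n !addn0 mul1n.
Qed.

Lemma residue_arith (a d n : nat) : (0 < a)%N -> coprime a d ->
  exists y, (y < a)%N /\ y * (a + d) = n %[mod a].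
Proof.
move=> a0 cad; have cad' : coprime a (a + d) by rewrite /coprime gcdnDl.
have /dvdnP [y yE] : (a + d %| chinese a (a + d) n 0)%N.
  by rewrite /dvdn chinese_modr // mod0n.
exists (y %% a)%N; split; first exact: ltn_pmod.
by rewrite modnMml -yE chinese_modl.
Qed.

Lemma min_residueP (a d k i : nat) : coprime a d -> (1 < k)%N ->
  (0 < i < a)%N ->
  residue_set a d k i (min_residue a d k i) /\
  forall m, residue_set a d k i m -> (min_residue a d k i <= m)%N.
Proof.
move=> cad k1 /andP[i0 ia]; have a0 : (0 < a)%N by apply: leq_trans ia.
apply: (@xgetPex _ 0%N [set m | residue_set a d k i m /\
                    forall m', residue_set a d k i m' -> (m <= m')%N]).
have [y [_ yi]] := residue_arith i a0 cad.
have n0 : (0 < y * (a + d))%N.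
  rewrite lt0n; apply/eqP => n0; move: yi; rewrite n0 mod0n modn_small // => i0'.
  by rewrite -i0' in i0.
have ex : exists m, `[< residue_set a d k i m >].
  exists (y * (a + d))%N; apply/asboolP; split=> //; split=> //.
  by have := @representable_arith2 a d k 0 y a0 k1; apply.
exists (ex_minn ex); case: ex_minnP => m /asboolP mi mmin; split=> // m' m'i.
by apply: mmin; apply/asboolP.
Qed.

Lemma finite_nonrepresentable_arith (a d k : nat) : (0 < a)%N ->
  coprime a d -> (1 < k)%N -> finite_set (nonrepresentable (@arith a d k)).
Proof.
move=> a0 cad k1; apply: (sub_finite_set _ (finite_II (a * (a + d)))).
move=> n /= [n0 nR]; rewrite ltnNge; apply/negP => le_n; apply: nR.
have [y [ya yn]] := residue_arith n a0 cad.
have yle : (y * (a + d) <= n)%N.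
  by apply: leq_trans le_n; rewrite leq_mul2r (ltnW ya) orbT.
have /dvdnP [x xE] : (a %| n - y * (a + d))%N.
  by rewrite -eqn_mod_dvd //; apply/eqP.
have nE : n = (x * a + y * (a + d))%N by rewrite -xE subnK.
by rewrite nE; apply: representable_arith2 => //; rewrite -nE.
Qed.

(* Main.v *)
Require Import Defs.
From mathcomp Require Import all_boot all_order all_algebra.
From mathcomp Require Import boolp classical_sets functions cardinality fsbigop.
From mathcomp Require Import reals.
From mathcomp Require Import complex.
From mathcomp Require Import ring.
Import Order.TTheory GRing.Theory Num.Theory.
Local Open Scope ring_scope.

(** The nonrepresentable integers congruent to [i] modulo [a] are exactly
    [i, i + a, ..., m_i - a], and none is congruent to 0
    ([nonrepresentableE]).  On such a progression [lambda ^+ n] is constant,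
    because [lambda ^+ a = 1].  Hence, for any [F] with
    [F(n + a) - F(n) = n ^ mu], the sum over the progression telescopes and
    the weighted sum is [\sum_i (F(m_i) - F(i)) lambda ^ m_i]
    ([weighted_sum_antidifference]).  The Faulhaber polynomial of step [a] is
    such an [F] ([faulhaber_shift]), by the defining recurrence of the Bernoulli
    numbers; expanding it gives the first formula.

    For the second formula one evaluates [S = \sum_(i < a) F(i) lambda ^ i].
    Formally, [\sum_(n >= 0) n ^ mu lambda ^ n] is
    [\sum_n F(n + a) lambda ^ (n + a) - \sum_n F(n) lambda ^ n = - S], and it
    is also the Eulerian sum divided by [(1 - lambda) ^ (mu + 1)]; but the
    series diverges, since [lambda] lies on the unit circle.  It is replaced
    by a polynomial argument.  As [lambda != 1], the operator
    [q |-> q(X) - lambda q(X + 1)] is onto and the degree need not grow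
    ([solve_twisted_difference]); its equation [G(X) - lambda G(X + 1) = F] is
    the algebraic version of [G(x) = \sum_n F(x + n) lambda ^ n].  Telescoping
    gives [S = G(0) - G(a)], that is [- H(0)] for [H = G(X + a) - G(X)]; and
    [H(n) - lambda H(n + 1) = n ^ mu].  Substituting this expression for
    [n ^ mu] in the explicit formula of the Eulerian numbers turns the Eulerian
    sum into [(1 - lambda) ^ (mu + 1) H(0)] minus a multiple of a finite
    difference of order [mu + 1] of [H], which vanishes because [H] has degree
    at most [mu] ([eulerian_sum_twisted_difference]). *)

(** * Bernoulli numbers and binomial coefficients *)

Lemma exchange_triangle (V : nmodType) (N : nat) (T : nat -> nat -> V) :
  \sum_(0 <= m < N) \sum_(0 <= k < m) T k m =
  \sum_(0 <= k < N) \sum_(k.+1 <= m < N) T k m.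
Proof.
rewrite (eq_big_nat _ _ (F2 := fun m => \sum_(0 <= k < N | (k < m)%N) T k m));
  last by move=> m /= mN; rewrite (big_nat_widen 0 m N) //; apply: ltnW.
rewrite (exchange_big_dep_nat xpredT) //=; apply: eq_bigr => k _.
by rewrite [RHS](big_nat_widenl _ 0).
Qed.

(** This is the coefficient of degree [s.+1] in the identity of power series
    that defines the Bernoulli numbers, multiplied by [(s.+1)!]. *)
Lemma bernoulli_rec (s : nat) :
  \sum_(0 <= n < s.+1) 'C(s.+1, n)%:R * bernoulli n = (s == 0%N)%:R.
Proof.
have fnz n : (n`!)%:R != 0 :> rat by rewrite pnatr_eq0 -lt0n fact_gt0.
have := congr1 (fun f => (s.+1)`!%:R * f s.+1) bernoulliP.
rewrite /= fps_mul_expm1 /fps_X eqSS => E.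
transitivity ((s.+1)`!%:R * (s == 0%N)%:R : rat).
  rewrite -{}E big_nat_recr //= binSn mulrDr addrC /fps_egf; congr (_ + _).
    by rewrite factS natrM -mulrA [X in _ = _ * X]mulrC mulfVK.
  rewrite big_mkord mulr_sumr; apply: eq_bigr => j _.
  have js : (j <= s.+1)%N by rewrite ltnW // ltnS ltnW.
  by rewrite -(bin_fact js) !natrM; field; rewrite !fnz.
by case: s {E} => [|s]; rewrite ?mulr1 ?mulr0.
Qed.

Lemma bin_trinomial (N s n : nat) : (n <= s <= N)%N ->
  ('C(N, n) * 'C(N - n, s - n) = 'C(N, s) * 'C(s, n))%N.
Proof.
move=> /andP[ns sN].
apply/eqP.
rewrite -(@eqn_pmul2r (n`! * (s - n)`! * (N - s)`!)) ?muln_gt0 ?fact_gt0 //.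
apply/eqP.
have h1 := bin_fact (leq_trans ns sN).
have h2 : ('C(N - n, s - n) * ((s - n)`! * (N - s)`!) = (N - n)`!)%N.
  have := @bin_fact (N - n) (s - n) (leq_sub2r _ sN).
  by rewrite subnBA // subnK // (leq_trans ns).
transitivity (N`!).
  by rewrite -h1 -h2; ring.
by rewrite -(bin_fact sN) -(bin_fact ns); ring.
Qed.

(** * The Faulhaber polynomial of step a *)

Section Field.
Variable K : numFieldType.
Implicit Types (p F G H : {poly K}) (a lambda x : K).

(** The polynomial with zero constant term whose difference of step [a] is
    ['X^mu]; it is [a ^ mu / (mu + 1) * (B_(mu + 1)(x / a) - B_(mu + 1))] in
    terms of Bernoulli polynomials. *)
Definition faulhaber a (mu : nat) : {poly K} :=
  (mu.+1)%:R^-1 *: \sum_(0 <= n < mu.+1)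
    ('C(mu.+1, n)%:R * ratr (bernoulli n) * a ^ (n%:Z - 1)) *: 'X^(mu.+1 - n).

Lemma horner_faulhaber a mu x :
  (faulhaber a mu).[x] = (mu.+1)%:R^-1 * \sum_(0 <= n < mu.+1)
    'C(mu.+1, n)%:R * ratr (bernoulli n) * a ^ (n%:Z - 1) * x ^+ (mu.+1 - n).
Proof.
rewrite /faulhaber hornerZ horner_sum; congr (_ * _).
by apply: eq_bigr => n _; rewrite hornerZ hornerXn.
Qed.

Lemma size_faulhaber a mu : (size (faulhaber a mu) <= mu.+2)%N.
Proof.
apply: leq_trans (size_scale_leq _ _) _.
apply: leq_trans (size_sum _ _ _) _; apply/bigmax_leqP_seq => n _ _.
by apply: leq_trans (size_scale_leq _ _) _; rewrite size_polyXn ltnS leq_subr.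
Qed.

Lemma faulhaber0 a mu : (faulhaber a mu).[0] = 0.
Proof.
rewrite horner_faulhaber big1_seq ?mulr0 // => n /=.
rewrite mem_index_iota => /= nmu.
by rewrite expr0n subn_eq0 leqNgt nmu mulr0.
Qed.

(** After multiplication by [N = mu + 1] and expansion of the powers of [x + a],
    the coefficient of [x ^ (N - s)] is [a ^ (s - 1) 'C(N, s)] times the sum of
    ['C(s, n) * bernoulli n] over [n < s], which vanishes unless [s = 1]. *)
Lemma faulhaber_shift a mu x : a != 0 ->
  (faulhaber a mu).[x + a] - (faulhaber a mu).[x] = x ^+ mu.
Proof.
move=> a0; set N := mu.+1.
have N0 : N%:R != 0 :> K by rewrite pnatr_eq0.
rewrite !horner_faulhaber -mulrBr -sumrB.
apply: (mulfI N0); rewrite mulVKf //.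
(* [s = n + l], where [l > 0] is the power of [a] in the binomial expansion. *)
pose T n s : K := 'C(N, n)%:R * ratr (bernoulli n) * a ^ (n%:Z - 1) *
      (x ^+ (N - s) * a ^+ (s - n) *+ 'C(N - n, s - n)).
transitivity (\sum_(0 <= n < N.+1) \sum_(n.+1 <= s < N.+1) T n s).
  rewrite [RHS]big_nat_recr //= [X in _ = _ + X]big_geq // addr0.
  apply: eq_big_nat => n /= nN; rewrite -mulrBr exprDn.
  rewrite big_ord_recl subn0 expr0 mulr1 bin0 mulr1n addrAC subrr add0r mulr_sumr.
  rewrite -[n.+1]add0n big_addn big_mkord subSS; apply: eq_bigr => i _.
  rewrite /T /= /bump leq0n add1n addnS; move: (nat_of_ord i) => j.
  by rewrite (subSn (leq_addl j n)) addnK -subnDA addnC addSn -addnS.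
rewrite -exchange_triangle.
transitivity (\sum_(0 <= s < N.+1) 'C(N, s)%:R * x ^+ (N - s) * a ^ (s%:Z - 1)
                 * ratr (\sum_(0 <= n < s) 'C(s, n)%:R * bernoulli n)).
  apply: eq_big_nat => s /= sN; rewrite raddf_sum mulr_sumr.
  apply: eq_big_nat => n /= ns; rewrite /T rmorphM /= ratr_nat.
  have -> : a ^ (s%:Z - 1) = a ^ (n%:Z - 1) * a ^+ (s - n).
    rewrite [a ^+ _]exprnP -expfzDr //; congr (_ ^ _).
    rewrite -subzn ?(ltnW ns) //; ring.
  have E : 'C(N, n)%:R * 'C(N - n, s - n)%:R = 'C(N, s)%:R * 'C(s, n)%:R :> K.
    by rewrite -!natrM bin_trinomial // (ltnW ns) -ltnS sN.
  rewrite -[_ *+ 'C(_, _)]mulr_natl.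
  transitivity (('C(N, n)%:R * 'C(N - n, s - n)%:R) * (x ^+ (N - s) *
      (a ^ (n%:Z - 1) * a ^+ (s - n)) * ratr (bernoulli n)) : K).
    by ring.
  by rewrite E; ring.
rewrite big_nat_recl // [X in ratr X]big_geq // [ratr _]rmorph0 mulr0 add0r.
rewrite big_nat_recl //= [X in _ + X]big1_seq ?addr0; last first.
  by move=> s _; rewrite bernoulli_rec [ratr _]rmorph0 mulr0.
by rewrite bernoulli_rec ratr_nat /= mulr1 bin1 subrr expr0z mulr1 /N subSS subn0.
Qed.

(** * Finite differences of polynomials *)

Lemma size_shift_sub p a : (size (p \Po ('X + a%:P) - p)%R <= (size p).-1)%N.
Proof.
have [->|p0] := eqVneq p 0; first by rewrite comp_poly0 subrr size_poly0.
have sX : size ('X + a%:P) = 2 by rewrite size_XaddC.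
have sp := size_comp_poly2 p sX.
apply/leq_sizeP => j; rewrite leq_eqVlt => /orP[/eqP <-|].
  rewrite coefB -[X in _ - X]/(lead_coef p) -{1}sp -[X in X - _]/(lead_coef _).
  by rewrite lead_coef_comp ?sX // lead_coefXaddC expr1n mulr1 subrr.
rewrite prednK ?size_poly_gt0 // => pj.
by rewrite coefB !nth_default ?subrr // sp.
Qed.

(** The [N.+1]-st difference of [f] is the [N]-th difference of its first
    difference, by Pascal's rule. *)
Lemma alternating_sumS (N : nat) (f : nat -> K) :
  \sum_(k < N.+2) (-1) ^+ k * 'C(N.+1, k)%:R * f (N.+1 - k)%N =
  \sum_(k < N.+1) (-1) ^+ k * 'C(N, k)%:R * (f (N - k).+1 - f (N - k)%N).
Proof.
rewrite big_ord_recl /= subn0 expr0 bin0 !mul1r.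
under eq_bigr => i _ do rewrite /bump /= add1n binS natrD subSS mulrDr mulrDl.
rewrite big_split /= addrA.
under [RHS]eq_bigr => i _ do rewrite mulrBr.
rewrite sumrB; congr (_ + _); last first.
  by rewrite -sumrN; apply: eq_bigr => i _; rewrite exprS mulN1r !mulNr.
rewrite big_ord_recr /= bin_small // mulr0 mul0r addr0.
rewrite [RHS]big_ord_recl /= subn0 expr0 bin0 !mul1r; congr (_ + _).
apply: eq_bigr => i _; rewrite /bump /= add1n; congr (_ * f _).
by rewrite subnSK.
Qed.

Lemma alternating_sum_poly (N : nat) p : (size p <= N)%N ->
  \sum_(k < N.+1) (-1) ^+ k * 'C(N, k)%:R * p.[(N - k)%:R] = 0.
Proof.
elim: N p => [|N IH] p sp.
  move: sp; rewrite size_poly_leq0 => /eqP ->.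
  by rewrite big1 // => i _; rewrite horner0 mulr0.
rewrite (alternating_sumS N (fun j => p.[j%:R])).
rewrite -[RHS](IH (p \Po ('X + 1%:P) - p)); last first.
  by apply: leq_trans (size_shift_sub _ _) _; case: (size p) sp.
apply: eq_bigr => k _; rewrite hornerD hornerN horner_comp !hornerE.
by rewrite -natr1.
Qed.

(** * Twisted differences and Eulerian numbers *)

(** On polynomials of given degree, the operator multiplies the leading
    coefficient by [1 - lambda], which is invertible, so that [G] is found by
    removing the leading term of [p] and induction on the size. *)
Lemma solve_twisted_difference lambda (n : nat) p : lambda != 1 ->
  (size p <= n)%N ->
  exists2 G : {poly K}, (size G <= n)%N & G - lambda *: (G \Po ('X + 1%:P)) = p.
Proof.
move=> l1; elim: n p => [|n IH] p sp.
  exists 0; rewrite ?size_poly0 // comp_poly0 scaler0 subr0.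
  by move: sp; rewrite size_poly_leq0 => /eqP ->.
have sX : size ('X + 1%:P : {poly K}) = 2 by rewrite size_XaddC.
pose D q : {poly K} := q - lambda *: (q \Po ('X + 1%:P)).
pose c := p`_n / (1 - lambda).
have sXn : size ('X^n \Po ('X + 1%:P) : {poly K}) = n.+1.
  by rewrite size_comp_poly2 // size_polyXn.
have coefXn1 : ('X^n \Po ('X + 1%:P) : {poly K})`_n = 1.
  have : lead_coef ('X^n \Po ('X + 1%:P) : {poly K}) = 1.
    by rewrite lead_coef_comp ?sX // lead_coefXaddC expr1n lead_coefXn mulr1.
  by rewrite lead_coefE sXn.
have [|G sG DG] := IH (p - D (c *: 'X^n)).
  apply/leq_sizeP => j; rewrite leq_eqVlt => /orP[/eqP <-|nj].
    rewrite /D comp_polyZ !(coefB, coefZ) coefXn1 coefXn eqxx !mulr1.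
    rewrite [lambda * c]mulrC -{1}[c]mulr1 -mulrBr /c mulfVK ?subrr //.
    by rewrite subr_eq0 eq_sym.
  rewrite /D comp_polyZ !(coefB, coefZ) nth_default; last exact: leq_trans nj.
  rewrite [_`_j]nth_default ?size_polyXn // [_`_j]nth_default ?sXn //.
  by rewrite !(mulr0, subr0).
exists (G + c *: 'X^n).
  rewrite (leq_trans (size_polyD _ _)) // geq_max (leqW sG) /=.
  by rewrite (leq_trans (size_scale_leq _ _)) ?size_polyXn.
by rewrite comp_polyD scalerDr opprD addrACA DG subrK.
Qed.

(** [H.[0]] plays the role of the value of the divergent series
    [\sum_n n ^ mu * lambda ^ n].  After exchanging the sums, the sum of
    [n ^ mu * lambda ^ n] over [n] telescopes to
    [H.[0] - lambda ^ (N - k) * H.[N - k]]; the first terms make up a binomial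
    expansion and the second ones a finite difference of order [N]. *)
Lemma eulerian_sum_twisted_difference lambda (mu : nat) H :
  (0 < mu)%N -> (size H <= mu.+1)%N ->
  (forall n : nat, H.[n%:R] - lambda * H.[n.+1%:R] = n%:R ^+ mu) ->
  \sum_(0 <= j < mu) (eulerian mu j)%:~R * lambda ^+ j.+1 =
  (1 - lambda) ^+ mu.+1 * H.[0].
Proof.
move=> mu0 sH HE; set N := mu.+1.
pose T k m : K := (-1) ^+ k * 'C(N, k)%:R * ((m - k)%:R ^+ mu * lambda ^+ m).
transitivity (\sum_(0 <= m < N) \sum_(0 <= k < m) T k m).
  rewrite [RHS]big_nat_recl // [X in X + _]big_geq // add0r.
  apply: eq_bigr => j _; rewrite /eulerian rmorph_sum mulr_suml /=.
  apply: eq_big_nat => k /= kj; rewrite /T !rmorphM /= rmorphXn /= rmorphN1.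
  by rewrite addn1 -subSn // -!pmulrn natrX !mulrA.
rewrite exchange_triangle.
(* The term [0 ^ mu] vanishes, so that the telescoping sum may start at 1. *)
have H0 : H.[0] = lambda * H.[1].
  by have /eqP := HE 0%N; rewrite expr0n gtn_eqF // subr_eq0 => /eqP.
transitivity (\sum_(k < N.+1) (-1) ^+ k * 'C(N, k)%:R *
    (lambda ^+ k * H.[0] - lambda ^+ N * H.[(N - k)%:R])).
  (* The term [k = N] of the right-hand side is zero. *)
  rewrite big_ord_recr /= subnn subrr mulr0 addr0 big_mkord.
  apply: eq_bigr => k _; rewrite -mulr_sumr; congr (_ * _).
  rewrite (telescope_sumr_eq (fun m => - (lambda ^+ m * H.[(m - k)%:R]))) //.
    by rewrite subSnn opprK addrC exprSr H0 !mulrA.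
  by move=> m /andP[km _]; rewrite -HE exprSr subSn ?(ltnW km) //; ring.
under eq_bigr => k _ do rewrite mulrBr.
rewrite sumrB.
have -> : \sum_(k < N.+1) (-1) ^+ k * 'C(N, k)%:R * (lambda ^+ N * H.[(N - k)%:R]) = 0.
  transitivity (lambda ^+ N * \sum_(k < N.+1) (-1) ^+ k * 'C(N, k)%:R * H.[(N - k)%:R]).
    by rewrite mulr_sumr; apply: eq_bigr => k _; rewrite mulrCA.
  by rewrite alternating_sum_poly // mulr0.
rewrite subr0 exprBn mulr_suml; apply: eq_bigr => k _.
by rewrite expr1n mulr1 mulrnAl -[RHS]mulr_natl !mulrA [(-1) ^+ k * _]mulrC.
Qed.

(** With [G(x) - lambda G(x + 1) = F(x)], the sum over a period telescopes to
    [G.[0] - G.[a]], as [lambda ^+ a = 1], while [G(X + a) - G(X)] solves the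
    twisted difference equation for ['X^mu]. *)
Lemma sum_root_of_unity_eulerian lambda (a mu : nat) F :
  lambda != 1 -> lambda ^+ a = 1 -> (0 < mu)%N -> (size F <= mu.+2)%N ->
  (forall n : nat, F.[n%:R + a%:R] - F.[n%:R] = n%:R ^+ mu) ->
  \sum_(0 <= j < mu) (eulerian mu j)%:~R * lambda ^+ j.+1 =
  - (1 - lambda) ^+ mu.+1 * \sum_(0 <= i < a) F.[i%:R] * lambda ^+ i.
Proof.
move=> l1 la mu0 sF FE.
have [G sG GE] := solve_twisted_difference _ _ _ l1 sF.
have GEx x : G.[x] - lambda * G.[x + 1] = F.[x].
  by rewrite -GE !hornerE horner_comp !hornerE.
pose H := G \Po ('X + a%:R%:P) - G.
have HEx x : H.[x] = G.[x + a%:R] - G.[x] by rewrite /H !hornerE horner_comp !hornerE.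
rewrite (@eulerian_sum_twisted_difference lambda mu H) //; first last.
- move=> n; rewrite -FE -!GEx !HEx -natr1 [n%:R + 1 + _]addrAC; ring.
- by apply: leq_trans (size_shift_sub _ _) _; case: (size G) sG.
rewrite mulNr -mulrN; congr (_ * _).
rewrite (telescope_sumr_eq (fun i => - (G.[i%:R] * lambda ^+ i))) //; last first.
  move=> i _; rewrite -GEx mulrBl opprK addrC -natr1 exprS mulrA.
  by rewrite [lambda * _]mulrC.
by rewrite la expr0 !mulr1 opprK opprD opprK HEx add0r.
Qed.

End Field.

(** * Nonrepresentable integers as a union of progressions *)

Section Progression.
Variables a d k : nat.
Hypotheses (ha : (0 < a)%N) (had : coprime a d) (hk : (1 < k)%N).
Let m := min_residue a d k.

Lemma representable_add_multiple n t :
  representable (@arith a d k) n -> representable (@arith a d k) (n + t * a).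
Proof.
case=> n0 [c cE]; split; first by rewrite addn_gt0 n0.
exists (fun i : 'I_k => c i + (if i == 0%N :> nat then t else 0))%N.
rewrite cE; under [RHS]eq_bigr => i _ do rewrite mulnDl.
rewrite big_split /=; congr (_ + _)%N.
case: k hk c cE => // k' _ _ _; rewrite big_ord_recl /= big1 ?addn0 //.
by rewrite /arith mul0n addn0.
Qed.

Lemma min_residue_div i : (0 < i < a)%N -> m i = (i + (m i %/ a) * a)%N.
Proof.
move=> ia; have [[_ [E _]] _] := min_residueP had hk ia.
case/andP: ia => _ ia; rewrite (modn_small ia) in E.
by rewrite [LHS](divn_eq _ a) [X in (_ + X)%N]E addnC.
Qed.

(** Multiples of [a] are representable, and representability persists when [a]
    is added; hence, in the class of [i != 0], the nonrepresentable integers are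
    those below [m i]. *)
Lemma nonrepresentableE n :
  nonrepresentable (@arith a d k) n <->
  exists i j, [/\ (0 < i < a)%N, (j < m i %/ a)%N & n = (i + j * a)%N].
Proof.
split=> [[n0 nR]|[i [j [ia jm ->]]]].
  have i0 : (0 < n %% a)%N.
    rewrite lt0n; apply/negP => /eqP na; apply: nR.
    have nE := divn_eq n a; rewrite na addn0 in nE.
    have := @representable_arith2 a d k (n %/ a) 0 ha hk.
    by rewrite mul0n addn0 -nE; apply.
  have ia : (0 < n %% a < a)%N by rewrite i0 ltn_pmod.
  exists (n %% a)%N, (n %/ a)%N; split=> //; last by rewrite addnC -divn_eq.
  rewrite ltnNge; apply/negP => le_mn; apply: nR.
  have [[_ [_ mR]] _] := min_residueP had hk ia.
  suff -> : n = (m (n %% a) + (n %/ a - m (n %% a) %/ a) * a)%N.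
    exact: representable_add_multiple.
  rewrite {1}(min_residue_div _ ia) -addnA -mulnDl subnKC //.
  by rewrite addnC -divn_eq.
have [_ mmin] := min_residueP had hk ia.
have n0 : (0 < i + j * a)%N by case/andP: ia => i0 _; rewrite addn_gt0 i0.
split=> // nR; have : (m i <= i + j * a)%N.
  by apply: mmin; split=> //; split=> //; rewrite addnC modnMDl.
by rewrite (min_residue_div _ ia) leq_add2l leq_pmul2r // leqNgt jm.
Qed.

Lemma weighted_sum_progressions (K : nzRingType) (lambda : K) mu :
  weighted_sum lambda mu (@arith a d k) =
  \sum_(1 <= i < a) \sum_(0 <= j < m i %/ a)
     lambda ^+ (i + j * a) * (i + j * a)%:R ^+ mu.
Proof.
pose r := [seq (i + j * a)%N | i <- index_iota 1 a, j <- index_iota 0 (m i %/ a)].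
have ur : uniq r.
  apply: allpairs_uniq_dep => [|i _|]; rewrite ?iota_uniq //.
  move=> _ _ /allpairsPdep[i [j [ia _ ->]]] /allpairsPdep[i' [j' [ia' _ ->]]] /= E.
  rewrite !mem_index_iota in ia ia'.
  case/andP: ia => _ ia; case/andP: ia' => _ ia'.
  have ii : i = i'.
    have := congr1 (modn^~ a) E.
    by rewrite ![(_ + _ * a)%N]addnC !modnMDl !modn_small.
  move: E; rewrite ii => /addnI /eqP; rewrite eqn_pmul2r // => /eqP jj.
  by rewrite jj.
rewrite /weighted_sum.
have -> : nonrepresentable (@arith a d k) = [set` r]%classic.
  apply/seteqP; split=> n /=.
    move/nonrepresentableE => [i [j [ia jm ->]]].
    by apply/allpairsPdep; exists i, j; rewrite !mem_index_iota.
  move/allpairsPdep => [i [j []]]; rewrite !mem_index_iota => ia jm ->.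
  by apply/nonrepresentableE; exists i, j.
by rewrite -fsbig_seq // big_allpairs_dep.
Qed.

End Progression.

(** * The weighted sum *)

Lemma weighted_sum_antidifference {K : numFieldType} {a d k : nat} {lambda : K}
    {mu : nat} {F : {poly K}} :
  (0 < a)%N -> coprime a d -> (1 < k)%N -> lambda ^+ a = 1 ->
  (forall n : nat, F.[n%:R + a%:R] - F.[n%:R] = n%:R ^+ mu) ->
  weighted_sum lambda mu (@arith a d k) =
  \sum_(1 <= i < a) (F.[(min_residue a d k i)%:R] - F.[i%:R])
                     * lambda ^+ min_residue a d k i.
Proof.
move=> ha had hk la FE; rewrite weighted_sum_progressions //.
apply: eq_big_nat => i ia; set l := (_ %/ a)%N.
have periodic j : lambda ^+ (i + j * a) = lambda ^+ i.
  by rewrite exprD mulnC exprM la expr1n mulr1.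
rewrite (min_residue_div _ _ _ had hk _ ia) -/l periodic.
rewrite (telescope_sumr_eq (fun j => F.[(i + j * a)%:R] * lambda ^+ i)) //.
  by rewrite mulrBl mul0n addn0.
move=> j _; rewrite periodic -FE mulrC mulrBl mulSn.
by rewrite -natrD addnAC addnA.
Qed.

Theorem theorem5 (R : realType) (a d k : nat) (lambda : R[i]) (mu : nat)
    (ha : (0 < a)%N) (hd : (0 < d)%N) (had : gcdn a d = 1%N)
    (hk : (2 <= k <= a)%N)
    (hl0 : lambda != 0) (hl1 : lambda != 1) (hla : lambda ^+ a = 1)
    (hmu : (0 < mu)%N) :
  let m := min_residue a d k in
  weighted_sum lambda mu (@arith a d k)
    = (mu.+1)%:R^-1 *
      \sum_(0 <= n < mu.+1) 'C(mu.+1, n)%:R * ratr (bernoulli n) *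
        (a%:R : R[i]) ^ (n%:Z - 1) *
        \sum_(1 <= i < a)
          ((m i)%:R ^+ (mu.+1 - n) - i%:R ^+ (mu.+1 - n)) * lambda ^+ m i
  /\
  weighted_sum lambda mu (@arith a d k)
    = (mu.+1)%:R^-1 *
      (\sum_(0 <= n < mu.+1) 'C(mu.+1, n)%:R * ratr (bernoulli n) *
        (a%:R : R[i]) ^ (n%:Z - 1) *
        \sum_(1 <= i < a) (m i)%:R ^+ (mu.+1 - n) * lambda ^+ m i)
      + (-1) ^+ mu.+1 / (lambda - 1) ^+ mu.+1 *
        \sum_(0 <= j < mu) (eulerian mu j)%:~R * lambda ^+ j.+1.
Proof.
move=> m.
have had' : coprime a d by apply/eqP.
have [hk1 _] := andP hk.
pose F := faulhaber R[i] a%:R mu.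
have FE (n : nat) : F.[n%:R + a%:R] - F.[n%:R] = n%:R ^+ mu.
  by apply: faulhaber_shift; rewrite pnatr_eq0 -lt0n.
have sumF (x : nat -> nat) : \sum_(1 <= i < a) F.[(x i)%:R] * lambda ^+ m i =
    (mu.+1)%:R^-1 * \sum_(0 <= n < mu.+1) 'C(mu.+1, n)%:R * ratr (bernoulli n) *
        (a%:R : R[i]) ^ (n%:Z - 1) *
        \sum_(1 <= i < a) (x i)%:R ^+ (mu.+1 - n) * lambda ^+ m i.
  under [in RHS]eq_bigr => n _ do rewrite mulr_sumr.
  rewrite exchange_big /= mulr_sumr; apply: eq_bigr => i _.
  rewrite horner_faulhaber -mulrA mulr_suml; congr (_ * _).
  by apply: eq_bigr => n _; rewrite -[LHS]mulrA.
have wE : weighted_sum lambda mu (@arith a d k) =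
    \sum_(1 <= i < a) F.[(m i)%:R] * lambda ^+ m i -
    \sum_(1 <= i < a) F.[i%:R] * lambda ^+ m i.
  rewrite (weighted_sum_antidifference ha had' hk1 hla FE) -sumrB.
  by apply: eq_bigr => i _; rewrite mulrBl.
split.
  rewrite wE !sumF -mulrBr -sumrB; congr (_ * _); apply: eq_bigr => n _.
  rewrite -mulrBr -sumrB; congr (_ * _); apply: eq_bigr => i _.
  by rewrite mulrBl.
rewrite wE sumF; congr (_ + _).
have l1 : 1 - lambda != 0 by rewrite subr_eq0 eq_sym.
rewrite (sum_root_of_unity_eulerian _ lambda a mu F) ?size_faulhaber //.
rewrite -[lambda - 1]opprB (exprNn (1 - lambda)) invfM mulVKf ?signr_eq0 //.
rewrite mulNr mulrN mulKf ?expf_neq0 //; congr (- _).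
rewrite [RHS]big_ltn // faulhaber0 mul0r add0r.
apply: eq_big_nat => i ia; congr (_ * _).
by rewrite /m (min_residue_div _ _ _ had' hk1 _ ia) exprD mulnC exprM hla expr1n mulr1.
Qed.
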